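(* Let $(X,d,m)$ be a compact Ahlfors $Q$-regular space, $Q>0$, let $1<p<+\infty$, $\frac1p+\frac1{p'}=1$, and $\frac1{p'}\le s<1$. There exists a constant $A$, depending only on $X$, $s$ and $p$ (and the kernel $K_{X,s}$), such that the following holds. For every countable family of balls $\{B_d(x_j,r_j)\}_j$ in $X$, with $x_j\in X$, $r_j>0$, such that $\eta_{X,p}(x_j,r_j)$ exists for all $j$ and such that the family $\{B_d(x_j,\eta^*_{X,p}(x_j,r_j))\}_j$ is pairwise disjoint, and for all compact sets $E_j$ with $E_j\subseteq B_d(x_j,r_j)$, one has $$\sum_j C_{K_{X,s},p}(E_j)\le A\cdot C_{K_{X,s},p}\Big(\bigcup_j E_j\Big).$$
   Context: $(X,d,m)$ is a compact metric measure space, $B_d(x,r)=\{y\in X: d(x,y)<r\}$. It is Ahlfors $Q$-regular: there are constants $0<C_1\le C_2<+\infty$ with $C_1r^Q\le m(B_d(x,r))\le C_2r^Q$ for all $x\in X$ and $0<r<\mathrm{diam}(X)$. Throughout, $m$ is taken to be the $Q$-dimensional Hausdorff measure (in particular it is a regular Borel measure). Riesz kernel: $K_{X,s}(x,y)=d(x,y)^{-Qs}$ (equal to $+\infty$ on the diagonal), and $K_{X,s}*f(x)=\int_X K_{X,s}(x,y)f(y)\,dm(y)$. Capacity: for $E\subseteq X$, $C_{K_{X,s},p}(E):=\inf\{\|f\|^p_{L^p(X,m)}: f\in L^p(X,m),\ K_{X,s}*f(x)\ge1\ \forall x\in E\}$. Radii: for $x\in X$, $r>0$, $$\eta_{X,p}(x,r):=\inf\{R>0: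 m(B_d(x,R))\ge C_{K_{X,s},p}(B_d(x,r))\},$$ which is said to exist when the set on the right is non-empty, and $\eta^*_{X,p}(x,r):=\max\{r,\eta_{X,p}(x,r)\}$. *)

(* Defs.v *)
From HB Require Import structures.
From mathcomp Require Import all_boot all_order all_algebra.
From mathcomp Require Import all_classical all_reals all_analysis.

Set Implicit Arguments.
Unset Strict Implicit.
Unset Printing Implicit Defensive.

Import Order.TTheory GRing.Theory Num.Theory.
Import numFieldNormedType.Exports.

Local Open Scope classical_set_scope.
Local Open Scope ring_scope.
Local Open Scope ereal_scope.

(* The library's measurable types are pointed, so the metric spaces below are
   nonempty. *)
#[short(type="pointedMetricType")]
HB.structure Definition PointedMetric (K : numDomainType) :=
  {M of Pointed M & Metric K M}.

Notation borel X := (g_sigma_algebraType (@open X)).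

Section HausdorffMeasure.
Context {R : realType} {X : metricType R}.

(* The maximum with 0 makes diam set0 = 0 instead of -oo. *)
Definition diam (A : set X) : \bar R :=
  maxe 0 (ereal_sup [set (mdist x y)%:E | x in A & y in A]).

Definition hausdorff_content (Q delta : R) (A : set X) : \bar R :=
  ereal_inf [set \sum_(0 <= k <oo) diam (U k) `^ Q |
    U in [set U : (set X)^nat |
      A `<=` \bigcup_k U k /\ forall k, diam (U k) <= delta%:E]].

(* Q-dimensional Hausdorff outer measure, without normalizing factor. *)
Definition hausdorff_measure (Q : R) (A : set X) : \bar R :=
  ereal_sup [set hausdorff_content Q delta A | delta in [set d : R | (0 < d)%R]].

End HausdorffMeasure.

Section RieszCapacity.
Context {R : realType} {X : pointedMetricType R}.
Implicit Types (m : {measure set (borel X) -> \bar R}).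

Definition is_hausdorff_measure m (Q : R) : Prop :=
  forall A : set (borel X), measurable A -> m A = hausdorff_measure Q (A : set X).

Definition ahlfors_regular m (Q : R) : Prop :=
  exists C1 C2 : R, [/\ (0 < C1)%R, (C1 <= C2)%R &
    forall (x : X) (r : R), (0 < r)%R -> r%:E < diam [set: X] ->
      (C1 * r `^ Q)%:E <= m (ball x r) <= (C2 * r `^ Q)%:E].

(* The diagonal is treated separately because the library sets
   0 `^ a = 0 for a < 0. *)
Definition riesz_kernel (Q s : R) (x y : X) : \bar R :=
  if x == y then +oo else (mdist x y `^ (- (Q * s)))%:E.

(* For f of arbitrary sign the library integral is the integral of the positive
   part minus that of the negative part, with +oo - +oo = -oo: a potential
   undefined at x is thus never >= 1 at x. *)
Definition riesz_potential m (Q s : R) (f : borel X -> R) (x : X) : \bar R :=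
  \int[m]_y (riesz_kernel Q s x y * (f y)%:E).

(* The infimum of the empty set is +oo. *)
Definition capacity m (Q s p : R) (E : set X) : \bar R :=
  ereal_inf [set 'N[m]_(p%:E)[EFin \o f] `^ p |
    f in [set f : borel X -> R | f \in Lfun m p%:E /\
      forall x, E x -> 1 <= riesz_potential m Q s f x]].

Definition eta_set m (Q s p : R) (x : X) (r : R) : set R :=
  [set rho : R | (0 < rho)%R /\ capacity m Q s p (ball x r) <= m (ball x rho)].

Definition eta_exists m (Q s p : R) (x : X) (r : R) : Prop :=
  eta_set m Q s p x r !=set0.

Definition eta m (Q s p : R) (x : X) (r : R) : R := inf (eta_set m Q s p x r).

Definition eta_star m (Q s p : R) (x : X) (r : R) : R :=
  Num.max r (eta m Q s p x r).

End RieszCapacity.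

(* Main.v *)
From HB Require Import structures.
Require Import Defs.
From mathcomp Require Import all_boot all_order all_algebra.
From mathcomp Require Import finmap measurable_realfun ring lra.
From mathcomp Require Import all_classical all_reals all_analysis.

(* A nonnegative test function f for the union of the E_j is split, for each j,
   into its restriction to B_j = B(x_j, eta*_j) and the rest. If the restriction
   has potential at least 1/2 on E_j, then 2 f 1_{B_j} is a test function for
   E_j, and these contributions add up since the B_j are disjoint. Otherwise the
   rest has potential at least 1/2 at a point of E_j; when eta*_j >= 2 r_j, the
   kernel satisfies a Harnack inequality that makes the potential of f bounded
   below on B(x_j, eta*_j / 2), whose measure dominates C(B(x_j, r_j)) by the
   definition of eta and doubling. As the potential operator is of weak type
   (p, p), the measure of the union of these half balls is at most a multiple of
   the p-th power of the L^p norm of f. The condition eta*_j >= 2 r_j holds as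
   soon as r_j < r_0, because the weak type estimate restricted to a ball gives
   m(B(x, r)) <= const r^{Q(1-s)} C(B(x, r)); and there are boundedly many
   disjoint balls of radius at least r_0. *)

Set Implicit Arguments.
Unset Strict Implicit.
Unset Printing Implicit Defensive.

Import Order.TTheory GRing.Theory Num.Theory.
Import numFieldNormedType.Exports.

Local Open Scope classical_set_scope.
Local Open Scope ring_scope.

(** * Measurability of balls and of the distance *)

Lemma countable_bigcup_measurable d (T : sigmaRingType d) (I : Type)
    (D : set I) (F : I -> set T) : countable D ->
  (forall i, D i -> measurable (F i)) -> measurable (\bigcup_(i in D) F i).
Proof.
have [->|/set0P[r Dr]] := eqVneq D set0; first by rewrite bigcup_set0.
move=> /countable_injP[f injf] mF.
(* The union is reindexed by the image of [D] under an injection into the natural numbers; [r] is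
   the default value of the pseudo-inverse, hence the separate empty case. *)
rewrite -(injpinv_image (cst r) injf) bigcup_image.
by apply: bigcup_measurable => _ /= [i Di <-]; apply: mF; rewrite pinvKV ?inE.
Qed.

Section Measurability.
Context {R : realType} {X : pointedMetricType R}.

Lemma open_mball (x : X) (r : R) : open (ball x r).
Proof.
rewrite openE => y; rewrite ballEmdist /= => xyr.
apply/nbhs_ballP; exists (r - mdist x y) => /=; first by rewrite subr_gt0.
move=> z; rewrite !ballEmdist /= => yz.
by rewrite (le_lt_trans (metric_triangle _ y _))// -ltrBrDl.
Qed.

Lemma measurable_mball (x : X) (r : R) : measurable (ball x r : set (borel X)).
Proof. by apply: sub_sigma_algebra; exact: open_mball. Qed.

Lemma measurable_mdist (x : X) :
  measurable_fun [set: borel X] (mdist x : borel X -> R).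
Proof.
move=> mD; apply: (measurability _ (RGenInftyO.measurableE R)) => //.
move=> _ [_ [a ->] <-]; rewrite setTI.
rewrite (_ : _ @^-1` _ = (ball x a : set (borel X))).
  exact: measurable_mball.
by rewrite ballEmdist; apply/seteqP; split => y /=; rewrite in_itv.
Qed.

(** Compactness gives a countable basis, and each sublevel set of the distance is a countable union
    of rectangles of basic open sets. This places it in the product of the Borel sigma-algebras, as
    Tonelli's theorem requires. *)
Lemma measurable_mdist_prod : compact [set: X] ->
  measurable_fun [set: (borel X * borel X)%type] (fun z => mdist z.1 z.2 : R).
Proof.
move=> /compact_second_countable[B cB [oB bB]].
move=> mD; apply: (measurability _ (RGenInftyO.measurableE R)) => //.
move=> _ [_ [a ->] <-]; rewrite setTI.
pose good := [set UV : set X * set X | [/\ B UV.1, B UV.2 &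
  forall x y, UV.1 x -> UV.2 y -> mdist x y < a]].
rewrite (_ : _ @^-1` _ =
  \bigcup_(UV in good) ((UV.1 : set (borel X)) `*` (UV.2 : set (borel X)))); last first.
  apply/seteqP; split => [[x y]|[x y] [[U V] [BU BV] /= UVa [Ux Vy]]] /=; rewrite in_itv/=.
    move=> xya; pose e := (a - mdist x y) / 2.
    have e0 : 0 < e by rewrite divr_gt0// subr_gt0.
    have [U [BU Ux] Ue] := bB x (ball x e) (nbhsx_ballx _ _ e0).
    have [V [BV Vy] Ve] := bB y (ball y e) (nbhsx_ballx _ _ e0).
    exists (U, V) => //=; split => //= x' y' /Ue + /Ve.
    rewrite !ballEmdist /= => xx' yy'.
    rewrite (le_lt_trans (metric_triangle _ x _))// metric_sym.
    rewrite (le_lt_trans (lerD (lexx _) (metric_triangle _ y _)))//.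
    by rewrite /e in xx' yy'; lra.
  exact: UVa.
apply: countable_bigcup_measurable.
  apply: sub_countable (countableX cB cB).
  by apply: subset_card_le => -[U V] [].
move=> [U V] [/oB oU /oB oV _].
by apply: measurableX; exact: sub_sigma_algebra.
Qed.
End Measurability.

(** * The Riesz kernel *)

Section Kernel.
Context {R : realType} {X : pointedMetricType R}.
Implicit Types (Q s : R) (x y : X).

Lemma mdist_eq0 x y : (mdist x y == 0 :> R) = (x == y).
Proof.
by rewrite -[x == y]negbK -mdist_gt0 lt_neqAle mdist_ge0 andbT negbK eq_sym.
Qed.

Lemma riesz_kernelE Q s x y : riesz_kernel Q s x y =
  (fun t : R => if (t == 0)%R then +oo else (t `^ (- (Q * s)))%:E)%E (mdist x y).
Proof. by rewrite /riesz_kernel mdist_eq0. Qed.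

Lemma riesz_kernel_ge0 Q s x y : (0 <= riesz_kernel Q s x y)%E.
Proof. by rewrite /riesz_kernel; case: ifP => // _; rewrite lee_fin powR_ge0. Qed.

Lemma riesz_kernelC Q s x y : riesz_kernel Q s x y = riesz_kernel Q s y x.
Proof. by rewrite /riesz_kernel eq_sym metric_sym. Qed.

Lemma measurable_riesz_profile (a : R) : measurable_fun [set: R]
  (fun t : R => if (t == 0)%R then +oo else (t `^ a)%:E)%E.
Proof.
apply: measurable_fun_ifT => //.
  by apply: measurable_fun_eqr.
by apply/measurable_EFinP; exact: measurable_powR.
Qed.

Lemma measurable_riesz_kernel Q s x :
  measurable_fun [set: borel X] (riesz_kernel Q s x : borel X -> \bar R).
Proof.
rewrite (_ : riesz_kernel Q s x = (fun t : R =>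
    if (t == 0)%R then +oo else (t `^ (- (Q * s)))%:E)%E \o mdist x); last first.
  by apply/funext => y; rewrite riesz_kernelE.
by apply: measurableT_comp; [exact: measurable_riesz_profile|exact: measurable_mdist].
Qed.

Lemma measurable_riesz_kernel_prod Q s : compact [set: X] ->
  measurable_fun [set: (borel X * borel X)%type]
    (fun z => riesz_kernel Q s z.1 z.2 : \bar R).
Proof.
move=> cX; rewrite (_ : (fun z => _) = (fun t : R =>
    if (t == 0)%R then +oo else (t `^ (- (Q * s)))%:E)%E \o (fun z => mdist z.1 z.2)).
  by apply: measurableT_comp; [exact: measurable_riesz_profile|exact: measurable_mdist_prod].
by apply/funext => z; rewrite riesz_kernelE.
Qed.

Lemma powRN_le (a t u : R) : 0 <= a -> 0 < t -> t <= u -> u `^ (- a) <= t `^ (- a).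
Proof.
move=> a0 t0 tu; have u0 := lt_le_trans t0 tu.
rewrite !powRN lef_pV2 ?posrE ?powR_gt0//.
by apply: ge0_ler_powR => //; rewrite nnegrE ltW.
Qed.

Lemma riesz_kernel_far Q s x y (rho : R) : 0 <= Q * s -> 0 < rho ->
  ~ ball x rho y -> (riesz_kernel Q s x y <= (rho `^ (- (Q * s)))%:E)%E.
Proof.
move=> Qs0 r0; rewrite ballEmdist /= => /negP; rewrite -leNgt => rxy.
rewrite /riesz_kernel -mdist_eq0 gt_eqF ?(lt_le_trans r0)// lee_fin.
exact: powRN_le.
Qed.

(* On the diagonal the kernel is +oo, and so is the series: all the balls contain
   the center and the coefficients are bounded below. *)
Lemma riesz_kernel_dyadic Q s x y (rho : R) : 0 <= Q * s -> 0 < rho ->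
  ball x rho y ->
  (riesz_kernel Q s x y <= \sum_(0 <= k <oo)
     ((rho * 2^-1 ^+ k.+1) `^ (- (Q * s)))%:E
       * (\1_(ball x (rho * 2^-1 ^+ k)) y)%:E)%E.
Proof.
move=> Qs0 r0 yrho.
have u0 k : (0 <= ((rho * 2^-1 ^+ k.+1) `^ (- (Q * s)))%:E
    * (\1_(ball x (rho * 2^-1 ^+ k)) y)%:E :> \bar R)%E.
  by rewrite mule_ge0// lee_fin// powR_ge0.
have p0 k : 0 < rho * 2^-1 ^+ k by rewrite mulr_gt0// exprn_gt0.
have [xy|xy] := eqVneq x y.
  subst y; rewrite /riesz_kernel eqxx leye_eq; apply/eqP/eq_infty => t.
  have c0 : 0 < rho `^ (- (Q * s)) by rewrite powR_gt0.
  pose n := Num.truncn (t / rho `^ (- (Q * s))).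
  apply: le_trans (nneseries_lim_ge n.+1 _) => //.
  apply: (@le_trans _ _ (\sum_(0 <= k < n.+1) (rho `^ (- (Q * s)))%:E)%E).
    rewrite sumEFin lee_fin sumr_const_nat subn0 -mulr_natr mulrC -ler_pdivrMr//.
    exact/ltW/truncnS_gt.
  apply: lee_sum => k _; rewrite indicE mem_set ?mule1; last first.
    by rewrite ballEmdist /= mdistxx.
  rewrite lee_fin powRN_le// ger_pMr// exprn_ile1// invf_le1//.
  by rewrite ler1n.
rewrite /riesz_kernel (negbTE xy).
have d0 : 0 < mdist x y by rewrite mdist_gt0.
have exn : exists n, rho * 2^-1 ^+ n <= mdist x y.
  have e0 : 0 < mdist x y / rho by rewrite divr_gt0.
  near \oo => n; exists n.
  rewrite mulrC -ler_pdivlMr// exprVn -div1r; apply: ltW.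
  by near: n; exact: near_infty_natSinv_expn_lt (PosNum e0).
(* The least such index is positive, since [y] lies in the ball of radius [rho]. By minimality [y]
   lies in the dyadic ball of the preceding index, whose term alone dominates the kernel. *)
case: (ex_minnP exn) => n hn minn.
case: n hn minn => [|n] hn minn.
  by move: yrho; rewrite ballEmdist /= ltNge -[rho]mulr1 -(expr0 2^-1) hn.
have Bn : ball x (rho * 2^-1 ^+ n) y.
  rewrite ballEmdist /= ltNge; apply/negP => /minn; by rewrite ltnn.
apply: le_trans (nneseries_lim_ge n.+1 _) => //.
rewrite big_nat_recr//= (@le_trans _ _ (((rho * 2^-1 ^+ n.+1) `^ (- (Q * s)))%:E
    * (\1_(ball x (rho * 2^-1 ^+ n)) y)%:E)%E)//.
  by rewrite indicE mem_set// mule1 lee_fin powRN_le.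
by rewrite leeDr// sume_ge0.
Unshelve. all: by end_near. Qed.

Context (m : {measure set (borel X) -> \bar R}).

(** Integrated term by term, the dyadic series is dominated by a geometric series of ratio [q],
    which is less than 1 because [Q * s < Q]; [M] is its sum without the power of [rho]. *)
Lemma riesz_kernel_ball_bound Q s (Cu : R) : 0 <= Q * s -> Q * s < Q -> 0 <= Cu ->
  (forall x rho, 0 < rho -> (m (ball x rho) <= (Cu * rho `^ Q)%:E)%E) ->
  exists2 M : R, 0 <= M & forall x rho, 0 < rho ->
   (\int[m]_(y in ball x rho) riesz_kernel Q s x y <= (M * rho `^ (Q - Q * s))%:E)%E.
Proof.
move=> Qs0 QsQ Cu0 mCu.
pose q : R := 2^-1 `^ (Q - Q * s).
have q0 : 0 < q by rewrite powR_gt0.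
have q1 : q < 1.
  have <- : 1 `^ (Q - Q * s) = 1 :> R by rewrite powR1.
  by rewrite gt0_ltr_powR ?subr_gt0 ?nnegrE// invf_lt1// ltr1n.
exists (Cu * 2 `^ (Q * s) * (1 - q)^-1).
  by rewrite !mulr_ge0 ?powR_ge0// invr_ge0 subr_ge0 ltW.
move=> x rho r0.
have p0 k : 0 < rho * 2^-1 ^+ k by rewrite mulr_gt0// exprn_gt0.
pose u k (y : borel X) : \bar R := (((rho * 2^-1 ^+ k.+1) `^ (- (Q * s)))%:E
       * (\1_(ball x (rho * 2^-1 ^+ k) : set (borel X)) y)%:E)%E.
have u0 k y : (0 <= u k y)%E by rewrite mule_ge0// lee_fin// powR_ge0.
have mu k : measurable_fun [set: borel X] (u k).
  by apply: measurable_funeM; apply/measurable_EFinP; apply: measurable_indic; exact: measurable_mball.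
have mu' k : measurable_fun (ball x rho : set (borel X)) (u k) by exact: measurable_funTS.
apply: (@le_trans _ _ (\int[m]_(y in ball x rho) (\sum_(0 <= k <oo) u k y))%E).
  apply: ge0_le_integral => //.
  - exact: measurable_mball.
  - by move=> y _; exact: riesz_kernel_ge0.
  - by apply: measurable_funTS; exact: measurable_riesz_kernel.
  - rewrite (_ : (fun y => _) = (fun y => \sum_(0 <= k <oo | k \in xpredT) u k y)%E).
      exact: ge0_emeasurable_sum.
    by apply/funext => y; apply: congr_lim; apply/funext => n; apply: eq_bigl.
  - by move=> y yx; exact: riesz_kernel_dyadic.
rewrite integral_nneseries//; last exact: measurable_mball.
apply: (@le_trans _ _ (\sum_(0 <= k <oo)
    (geometric (Cu * 2 `^ (Q * s) * rho `^ (Q - Q * s)) q k)%:E)%E).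
  apply: lee_nneseries => [k _ _|k _]; first by apply: integral_ge0.
  rewrite ge0_integralZl_EFin//; [|exact: measurable_mball| |].
  - rewrite integral_indic//; [|exact: measurable_mball|exact: measurable_mball].
    apply: (@le_trans _ _ (((rho * 2^-1 ^+ k.+1) `^ (- (Q * s)))%:E *
       (Cu * (rho * 2^-1 ^+ k) `^ Q)%:E)%E).
      rewrite lee_pmul//; first by rewrite lee_fin powR_ge0.
      apply: le_trans (mCu x _ (p0 k)).
      apply: le_measure; rewrite ?inE//; last exact: measurable_mball.
      by apply: measurableI; exact: measurable_mball.
    rewrite -EFinM lee_fin /geometric /=.
    have b0 := p0 k; set b := rho * 2^-1 ^+ k in b0 *.
    have -> : rho * 2^-1 ^+ k.+1 = b * 2^-1 by rewrite exprSr mulrA.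
    have bE : rho `^ (Q - Q * s) * q ^+ k = b `^ (Q - Q * s).
      by rewrite powRM ?(ltW r0)// -(powR_mulrn k (ltW q0)) powRAC powR_mulrn.
    rewrite -(mulrA (Cu * _) _ (q ^+ k)) bE.
    rewrite (powRB (x := b)) ?(gt_eqF b0) ?implybT// (powRM _ (ltW b0))//.
    have h2 : (2^-1 : R) `^ (- (Q * s)) = 2 `^ (Q * s).
      by rewrite -(powR_inv1 (a := 2))// -powRrM mulrNN mul1r.
    rewrite h2 !powRN.
    rewrite le_eqVlt; apply/orP; left; apply/eqP; ring.
  - by apply/measurable_EFinP; apply: measurable_funTS; apply: measurable_indic; exact: measurable_mball.
  - exact: powR_ge0.
apply: lime_le.
  apply: is_cvg_nneseries => k _ _; rewrite lee_fin geometric_ge0//.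
    by rewrite !mulr_ge0 ?powR_ge0.
  exact: ltW.
apply: nearW => n; rewrite sumEFin lee_fin [leRHS]mulrAC.
apply: geometric_le_lim => //; last by rewrite ger0_norm ?ltW.
by rewrite !mulr_ge0 ?powR_ge0.
Qed.
End Kernel.

(** * A weak type estimate for integral operators *)

Section WeakType.
Context d (T : measurableType d) (R : realType).
Local Open Scope ereal_scope.

(** If [u <= t] the first term suffices; otherwise [u] is the product of its powers of exponents
    [1 - p] and [p], and the first factor decreases in [u]. *)
Lemma powR_young_split (p t u : R) : (1 <= p)%R -> (0 < t)%R -> (0 <= u)%R ->
  (u <= t + t `^ (1 - p) * u `^ p)%R.
Proof.
move=> p1 t0 u0; have [ut|tu] := leP u t.
  by rewrite (le_trans ut)// lerDl mulr_ge0// powR_ge0.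
have u_gt0 := lt_trans t0 tu.
apply: (@le_trans _ _ (t `^ (1 - p) * u `^ p)%R); last by rewrite lerDr ltW.
have uE : (u `^ (1 - p) * u `^ p = u)%R.
  by rewrite -powRD ?subrK ?powRr1// gt_eqF ?implybT.
rewrite -[X in (X <= _)%R]uE.
rewrite ler_wpM2r ?powR_ge0// -opprB.
rewrite !powRN lef_pV2 ?posrE ?powR_gt0//.
by rewrite ge0_ler_powR ?subr_ge0// ?nnegrE ltW.
Qed.

Lemma integral_indic_mul (mu : {measure set T -> \bar R}) (F : set T) (g : T -> \bar R) :
  \int[mu]_(x in F) g x = \int[mu]_x (g x * (\1_F x)%:E).
Proof. by rewrite integral_mkcond epatch_indic. Qed.

(* The inequality [f <= t + t^(1-p) f^p] with [t = c / (2 M)] bounds the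
   potential of [f] below [c / 2] plus a multiple of the potential of [f^p], and
   Tonelli's theorem integrates the latter over [F]. *)
Lemma weak_type_bound (mu : {sigma_finite_measure set T -> \bar R})
    (k : T * T -> \bar R) (f : T -> R) (F : set T) (p M S c : R) :
  measurable_fun [set: T * T] k -> (forall z, 0 <= k z) ->
  (forall x, \int[mu]_y k (x, y) <= M%:E) ->
  measurable F -> (forall y, \int[mu]_(x in F) k (x, y) <= S%:E) ->
  measurable_fun [set: T] f -> (forall x, 0 <= f x)%R ->
  (1 <= p)%R -> (0 < M)%R -> (0 < c)%R -> (0 <= S)%R ->
  (forall x, F x -> c%:E <= \int[mu]_y (k (x, y) * (f y)%:E)) ->
  mu F <= ((c / 2)^-1 * (c / (2 * M)) `^ (1 - p) * S)%:E
            * \int[mu]_y ((f y `^ p)%:E).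
Proof.
move=> mk k0 kM mF kS mf f0 p1 M0 c0 S0 kf.
set t := (c / (2 * M))%R; have t0 : (0 < t)%R by rewrite divr_gt0// mulr_gt0.
have mfp : measurable_fun [set: T] (fun y => (f y `^ p)%:E).
  by apply/measurable_EFinP; exact: (measurableT_comp (measurable_powR p)).
have fp0 y : 0 <= (f y `^ p)%:E by rewrite lee_fin powR_ge0.
have mk1 x : measurable_fun [set: T] (fun y => k (x, y)).
  exact: measurableT_comp.
have mk2 y : measurable_fun [set: T] (fun x => k (x, y)).
  exact: measurableT_comp.
pose h (z : T * T) := k z * (f z.2 `^ p)%:E.
have mh : measurable_fun [set: T * T] h.
  by apply: emeasurable_funM => //; exact: (measurableT_comp mfp).
have h0 z : 0 <= h z by rewrite mule_ge0.
pose g x := \int[mu]_y h (x, y).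
have mg : measurable_fun [set: T] g by exact: measurable_fun_fubini_tonelli_F.
have g0 x : 0 <= g x by apply: integral_ge0.
have cg x : F x -> (c / 2)%:E <= (t `^ (1 - p))%:E * g x.
  move=> Fx; have : c%:E <= (c / 2)%:E + (t `^ (1 - p))%:E * g x.
    apply: (le_trans (kf _ Fx)).
    apply: (@le_trans _ _ (\int[mu]_y (t%:E * k (x, y) +
        (t `^ (1 - p))%:E * h (x, y)))).
      apply: ge0_le_integral => //.
      - by move=> y _; rewrite mule_ge0// lee_fin.
      - by apply: emeasurable_funM => //; apply/measurable_EFinP.
      - apply: emeasurable_funD; first exact: measurable_funeM.
        by apply: measurable_funeM; exact: measurableT_comp.
      move=> y _; rewrite /h /= muleCA -[X in _ <= X + _]muleC -ge0_muleDr//.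
      - by rewrite lee_wpmul2l// -EFinM -EFinD lee_fin powR_young_split.
      - by rewrite lee_fin ltW.
      - by rewrite -EFinM lee_fin mulr_ge0// powR_ge0.
    rewrite ge0_integralD//; last 4 first.
    - by move=> y _; rewrite mule_ge0// lee_fin ltW.
    - exact: measurable_funeM.
    - by move=> y _; rewrite mule_ge0// lee_fin powR_ge0.
    - by apply: measurable_funeM; exact: measurableT_comp.
    rewrite !ge0_integralZl_EFin// ?powR_ge0 ?(ltW t0)//; last exact: measurableT_comp.
    rewrite leeD2r//.
    apply: (@le_trans _ _ (t%:E * M%:E)); first by rewrite lee_wpmul2l// lee_fin ltW.
    have -> : (c / 2 = t * M)%R by rewrite /t; field; rewrite gt_eqF.
    by rewrite EFinM.
  by rewrite {1}(splitr c) EFinD leeD2lE.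
have gS : \int[mu]_(x in F) g x <= S%:E * \int[mu]_y (f y `^ p)%:E.
  (* The indicator of [F] enters the integrand so that Tonelli applies on the whole product. *)
  pose H (z : T * T) := h z * (\1_F z.1)%:E.
  have m1 : measurable_fun [set: T] (fun x => (\1_F x)%:E : \bar R).
    by apply/measurable_EFinP; exact: measurable_indic.
  have i0 x : 0 <= (\1_F x)%:E :> \bar R by rewrite lee_fin.
  rewrite integral_indic_mul (eq_integral (fun x => \int[mu]_y H (x, y))); last first.
    move=> x _; rewrite /H /= ge0_integralZr//.
    exact: measurableT_comp.
  rewrite fubini_tonelli//; last 2 first.
  - by apply: emeasurable_funM => //; exact: (measurableT_comp m1).
  - by move=> z; rewrite mule_ge0.
  rewrite -ge0_integralZl_EFin//.
  apply: ge0_le_integral => //.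
  - by move=> y _; apply: integral_ge0 => x _; rewrite mule_ge0.
  - apply: measurable_fun_fubini_tonelli_G.
    by apply: emeasurable_funM => //; exact: (measurableT_comp m1).
    by move=> z; rewrite mule_ge0.
  - exact: measurable_funeM.
  move=> y _; rewrite /H /h /=.
  under eq_integral do rewrite muleAC.
  rewrite ge0_integralZr//; last 2 first.
  - by apply: emeasurable_funM.
  - by move=> x _; rewrite mule_ge0.
  by rewrite -integral_indic_mul lee_wpmul2r.
(* Chebyshev's inequality: [cg] is integrated over [F]. *)
have cF : (c / 2)%:E * mu F <= (t `^ (1 - p))%:E * (S%:E * \int[mu]_y (f y `^ p)%:E).
  rewrite -integral_cst//.
  apply: (@le_trans _ _ (\int[mu]_(x in F) ((t `^ (1 - p))%:E * g x))).
    apply: ge0_le_integral => //.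
    - by move=> x _; rewrite lee_fin ltW// divr_gt0.
    - by apply: measurable_funTS; exact: measurable_funeM.
  rewrite ge0_integralZl_EFin// ?powR_ge0//; last exact: measurable_funTS.
  by rewrite lee_wpmul2l// lee_fin powR_ge0.
rewrite -mulrA EFinM EFinM -!muleA.
have c20 : (0 < c / 2)%R by rewrite divr_gt0.
have -> : mu F = ((c / 2)^-1)%:E * ((c / 2)%:E * mu F).
  by rewrite muleA -EFinM mulVf ?lt0r_neq0// mul1e.
by rewrite lee_wpmul2l// lee_fin invr_ge0 ltW.
Qed.
End WeakType.

(** * Ahlfors regular spaces and capacity *)

Section Geometry.
Context {R : realType} {X : pointedMetricType R}.
Context (m : {measure set (borel X) -> \bar R}).

(** Finitely many balls of integer radius about [point] cover the space. The bound is strict so that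
    every ball of radius [D] is the whole space. *)
Lemma compact_mdist_bounded : compact [set: X] ->
  exists2 D : R, 0 < D & forall x y : X, mdist x y < D.
Proof.
rewrite compact_cover => /(_ nat setT (fun n => ball (point : X) n.+1%:R)).
case=> [n _|x _|D _ XD]; first exact: open_mball.
  exists (Num.truncn (mdist point x)) => //.
  by rewrite ballEmdist /=; exact: truncnS_gt.
pose N := (\max_(i <- D) i)%N.
have XN (x : X) : mdist point x < N.+1%:R.
  have [n nD] := XD x I; rewrite ballEmdist /= => /lt_le_trans; apply.
  by rewrite ler_nat ltnS; apply: leq_bigmax_seq.
exists (N.+1%:R + N.+1%:R); first by rewrite addr_gt0.
move=> x y; apply: (le_lt_trans (metric_triangle _ point _)).
by rewrite metric_sym ltrD.
Qed.

Lemma compact_measure_fin (r C : R) : compact [set: X] -> 0 < r ->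
  (forall x, (m (ball x r) <= C%:E)%E) -> (m [set: borel X] < +oo)%E.
Proof.
rewrite compact_cover => /(_ X setT (fun x => ball x r)) + r0 mC.
case=> [x _|x _|D _ XD]; first exact: open_mball.
  by exists x => //; exact: ballxx.
apply: (@le_lt_trans _ _ (\sum_(i \in [set` D]) m (ball i r))%E).
  apply: content_sub_fsum => //.
  by move=> i _; exact: measurable_mball.
rewrite fsbig_finite//= lte_sum_pinfty// => i _.
by rewrite (le_lt_trans (mC i))// ltry.
Qed.

(** Regularity only concerns radii below the diameter, which two distinct points make positive. The
    upper bound extends to all radii because the total mass is finite; the lower one is kept for
    radii up to [delta]. *)
Lemma ahlfors_regular_bounds (Q : R) (a b : X) : compact [set: X] -> 0 < Q ->
  ahlfors_regular m Q -> a != b ->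
  exists Cl Cu delta : R, [/\ 0 < Cl, 0 < Cu, 0 < delta,
   (forall x r, 0 < r -> r <= delta -> ((Cl * r `^ Q)%:E <= m (ball x r))%E) &
   (forall x r, 0 < r -> (m (ball x r) <= (Cu * r `^ Q)%:E)%E)].
Proof.
move=> cX Q0 [C1 [C2 [C10 C12 hC]]] ab.
have d0 : 0 < mdist a b by rewrite mdist_gt0.
pose delta := mdist a b / 2.
have delta0 : 0 < delta by rewrite divr_gt0.
have hdiam r : r <= delta -> (r%:E < diam [set: X])%E.
  move=> rd; apply: (@lt_le_trans _ _ (mdist a b)%:E).
    by rewrite lte_fin (le_lt_trans rd)// ltr_pdivrMr// ltr_pMr// ltr1n.
  rewrite /diam le_max; apply/orP; right.
  by apply: ereal_sup_ubound; exists a => //; exists b.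
have hdelta := fun x r r0 rd => andP (hC x r r0 (hdiam r rd)).
have mfin : (m [set: borel X] < +oo)%E.
  apply: (@compact_measure_fin delta (C2 * delta `^ Q)) => // x.
  by have [] := hdelta x _ delta0 (lexx _).
have mfn : m [set: borel X] \is a fin_num by rewrite ge0_fin_numE.
have C20 := lt_le_trans C10 C12.
pose C3 := fine (m [set: borel X]) / delta `^ Q.
have C30 : 0 <= C3 by rewrite divr_ge0 ?powR_ge0// fine_ge0.
exists C1, (C2 + C3), delta; split=> //.
- by rewrite ltr_pwDl.
- by move=> x r r0 rd; have [] := hdelta x _ r0 rd.
- move=> x r r0; have [rd|rd] := leP r delta.
    have [_ /le_trans] := hdelta x _ r0 rd; apply.
    by rewrite lee_fin ler_wpM2r ?powR_ge0// lerDl.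
  apply: (@le_trans _ _ (m [set: borel X])).
    by apply: le_measure; rewrite ?inE//; exact: measurable_mball.
  rewrite -(fineK mfn) lee_fin.
  apply: (@le_trans _ _ (C3 * r `^ Q)).
    rewrite /C3 mulrAC ler_pdivlMr ?powR_gt0// ler_wpM2l ?fine_ge0//.
    by apply: ge0_ler_powR; rewrite ?nnegrE ltW.
  by rewrite ler_wpM2r ?powR_ge0// lerDr ltW.
Qed.

Lemma quarter_ball_doubling (Q Cl Cu delta : R) : compact [set: X] -> 0 < Q ->
  0 < Cl -> 0 < Cu -> 0 < delta ->
  (forall x r, 0 < r -> r <= delta -> ((Cl * r `^ Q)%:E <= m (ball x r))%E) ->
  (forall x r, 0 < r -> (m (ball x r) <= (Cu * r `^ Q)%:E)%E) ->
  exists2 Cd : R, 0 < Cd & forall x r, 0 < r ->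
    (m (ball x r) <= Cd%:E * m (ball x (r / 4)))%E.
Proof.
move=> cX Q0 Cl0 Cu0 delta0 hl hu.
have [D D0 hD] := compact_mdist_bounded cX.
(* The summand 4 serves the case [t = r / 4], the summand [D / delta] the case [t = delta], where
   the ball is first shrunk to radius at most [D]. *)
pose L : R := 4 + D / delta.
have L0 : 0 < L by rewrite addr_gt0// divr_gt0.
exists (Cu / Cl * L `^ Q); first by rewrite mulr_gt0 ?powR_gt0// divr_gt0.
move=> x r r0.
pose t := Num.min (r / 4) delta.
have t0 : 0 < t by rewrite lt_min divr_gt0.
have tL : Num.min r D <= L * t.
  rewrite /t; have [r4d|r4d] := leP (r / 4) delta.
    rewrite ge_min; apply/orP; left; rewrite mulrDl mulrCA mulfV// mulr1 lerDl.
    by rewrite !mulr_ge0// ?invr_ge0 ltW.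
  rewrite ge_min; apply/orP; right; rewrite mulrDl divfK ?gt_eqF// lerDr.
  by rewrite mulr_ge0// ltW.
have minr0 : 0 < Num.min r D by rewrite lt_min r0.
have -> : ball x r = ball x (Num.min r D).
  by rewrite !ballEmdist; apply/seteqP; split => y /=; rewrite lt_min hD andbT.
apply: (le_trans (hu _ _ minr0)).
apply: (@le_trans _ _ ((Cu / Cl * L `^ Q)%:E * (Cl * t `^ Q)%:E)%E).
  rewrite -EFinM lee_fin.
  have -> : Cu / Cl * L `^ Q * (Cl * t `^ Q) = Cu * (L `^ Q * t `^ Q).
    by field; rewrite gt_eqF.
  rewrite -powRM ?(ltW L0) ?(ltW t0)// ler_wpM2l ?(ltW Cu0)//.
  by rewrite ge0_ler_powR ?nnegrE ?mulr_ge0 ?(ltW minr0) ?(ltW L0) ?(ltW t0) ?(ltW Q0).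
rewrite lee_wpmul2l//.
  by rewrite lee_fin mulr_ge0 ?powR_ge0// divr_ge0// ltW.
apply: (le_trans (hl x t t0 _)); first by rewrite /t ge_min lexx orbT.
apply: le_measure; rewrite ?inE; [exact: measurable_mball|exact: measurable_mball|].
by apply: le_ball; rewrite /t ge_min lexx.
Qed.

End Geometry.

(** * Capacity: test functions and the weak type estimate *)

Section Capacity.
Context {R : realType} {X : pointedMetricType R}.
Context (m : {measure set (borel X) -> \bar R}).
Local Open Scope ereal_scope.

(** The part of [F] in the ball is covered by the assumption; outside it the kernel is at most its
    value at distance [rho]. The point [x] is unrelated to [F], so the bound can be uniform in
    [x]. *)
Lemma riesz_kernel_set_bound (Q s M : R) (F : set (borel X)) (x : X) (rho : R) :
  (0 <= Q * s)%R -> (0 < rho)%R -> measurable F ->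
  \int[m]_(y in ball x rho) riesz_kernel Q s x y <= (M * rho `^ (Q - Q * s))%:E ->
  \int[m]_(y in F) riesz_kernel Q s x y
    <= (M * rho `^ (Q - Q * s))%:E + (rho `^ (- (Q * s)))%:E * m F.
Proof.
move=> Qs0 rho0 mF hM; have mB := measurable_mball x rho.
have mK A : measurable_fun A (riesz_kernel Q s x : borel X -> \bar R).
  by apply: measurable_funTS; exact: measurable_riesz_kernel.
have K0 := riesz_kernel_ge0 Q s x.
have mFB : measurable (F `\` (ball x rho : set (borel X))) by exact: measurableD.
apply: (@le_trans _ _ (\int[m]_(y in (ball x rho : set (borel X)) `|` (F `\` ball x rho))
    riesz_kernel Q s x y)).
  apply: ge0_subset_integral => //; first exact: measurableU.
  by move=> y Fy; have [By|nBy] := pselect (ball x rho y); [left|right].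
rewrite ge0_integral_setU//; last first.
  by apply/disj_setPS => y [? []].
apply: leeD => //.
apply: (@le_trans _ _ (\int[m]_(y in F `\` (ball x rho : set (borel X)))
    (rho `^ (- (Q * s)))%:E)).
  apply: ge0_le_integral => //.
  by move=> y [_]; exact: riesz_kernel_far.
rewrite integral_cst// lee_wpmul2l ?lee_fin ?powR_ge0//.
by apply: le_measure; rewrite ?inE//; exact: subDsetl.
Qed.

(** Membership in the Lebesgue space is not assumed: if the integral is infinite the bound is
    trivial. *)
Lemma capacity_le_test (Q s p : R) (E : set X) (f : borel X -> R) : (0 < p)%R ->
  measurable_fun [set: borel X] f -> (forall y, 0 <= f y)%R ->
  (forall x, E x -> 1 <= riesz_potential m Q s f x) ->
  capacity m Q s p E <= \int[m]_y (f y `^ p)%:E.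
Proof.
move=> p0 mf f0 fE.
have NE : 'N[m]_(p%:E)[EFin \o f] `^ p = \int[m]_y (f y `^ p)%:E.
  rewrite poweR_Lnorm ?gt_eqF//; apply: eq_integral => y _ /=.
  by rewrite ger0_norm.
have [->|] := eqVneq (\int[m]_y (f y `^ p)%:E) +oo; first by rewrite leey.
rewrite -ltey -NE => Nfin; apply: ereal_inf_lbound; exists f => //; split => //.
apply/andP; split; first by rewrite inE.
rewrite inE /finite_norm /=.
rewrite ltey; apply/eqP => Ny; move: Nfin; by rewrite Ny poweRyr ?gt_eqF// ltxx.
Qed.

(** Reduces to nonnegative test functions: passing from [f] to its absolute value keeps the norm,
    and the new potential dominates the integral of the positive part of the old integrand. *)
Lemma le_capacity (Q s p : R) (E : set X) (c : \bar R) : (0 < p)%R ->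
  (forall f : borel X -> R, measurable_fun [set: borel X] f ->
    (forall y, 0 <= f y)%R ->
    (forall x, E x -> 1 <= riesz_potential m Q s f x) ->
    c <= \int[m]_y (f y `^ p)%:E) ->
  c <= capacity m Q s p E.
Proof.
move=> p0 h; apply: le_ereal_inf_tmp => _ [f [/andP[+ _] fE] <-].
rewrite inE => mf.
rewrite poweR_Lnorm ?gt_eqF//; apply: (h (fun y => `|f y|%R)) => //.
  exact: measurableT_comp.
move=> x /fE/le_trans; apply; rewrite /riesz_potential.
have mK := measurable_riesz_kernel Q s x.
have mg : measurable_fun [set: borel X] (fun y => riesz_kernel Q s x y * (f y)%:E).
  by apply: emeasurable_funM => //; exact/measurable_EFinP.
rewrite integralE (@le_trans _ _ (\int[m]_y
    (fun y => riesz_kernel Q s x y * (f y)%:E)^\+ y))//.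
  by rewrite geeDl ?oppe_le0 ?integral_ge0.
apply: ge0_le_integral => //.
- exact: measurable_funepos.
- by apply: emeasurable_funM => //; apply/measurable_EFinP; exact: measurableT_comp.
move=> y _; rewrite funeposE ge_max; apply/andP; split.
  by rewrite lee_wpmul2l ?riesz_kernel_ge0// lee_fin ler_norm.
by rewrite mule_ge0 ?riesz_kernel_ge0.
Qed.

Lemma le_capacity_subset (Q s p : R) (E E' : set X) : E `<=` E' ->
  capacity m Q s p E <= capacity m Q s p E'.
Proof.
move=> EE'; apply: ereal_inf_le_tmp => _ [f [fL fE'] <-]; exists f => //.
by split => // x /EE' /fE'.
Qed.

Lemma esum_integral_disjoint (J : choiceType) (B : J -> set (borel X))
    (g : borel X -> \bar R) : trivIset [set: J] B ->
  (forall j, measurable (B j)) -> measurable_fun [set: borel X] g ->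
  (forall y, 0 <= g y) ->
  \esum_(j in [set: J]) \int[m]_(y in B j) g y <= \int[m]_y g y.
Proof.
move=> tB mB mg g0; apply: ge_ereal_sup => _ [A [finA _] <-].
rewrite fsbig_finite//= -ge0_integral_bigsetU//.
- apply: ge0_subset_integral => //.
  exact: bigsetU_measurable.
- exact: sub_trivIset tB.
- exact: measurable_funTS.
Qed.

Lemma riesz_weak_type (Q s p M S c : R) (f : borel X -> R) (F : set (borel X)) :
  compact [set: X] -> m [set: borel X] < +oo ->
  (forall x, \int[m]_y riesz_kernel Q s x y <= M%:E) ->
  measurable F -> (forall x, \int[m]_(y in F) riesz_kernel Q s x y <= S%:E) ->
  measurable_fun [set: borel X] f -> (forall x, 0 <= f x)%R ->
  (1 <= p)%R -> (0 < M)%R -> (0 < c)%R -> (0 <= S)%R ->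
  (forall x, F x -> c%:E <= riesz_potential m Q s f x) ->
  m F <= ((c / 2)^-1 * (c / (2 * M)) `^ (1 - p) * S)%:E
            * \int[m]_y ((f y `^ p)%:E).
Proof.
move=> cX mfin hM mF hS mf f0 p1 M0 c0 S0 hc.
have finm : fin_num_fun m.
  move=> A mA; rewrite ge0_fin_numE// (le_lt_trans _ mfin)//.
  by apply: le_measure; rewrite ?inE.
have sfin : sigma_finite setT m.
  by apply: fin_num_fun_sigma_finite => //; rewrite measure0.
(* The finite measure [m] is repackaged as a sigma-finite one, the form in which [weak_type_bound]
   takes its measure. *)
pose H1 := isSFinite.Build _ _ _ _ (sfinite_measure_sigma_finite sfin).
pose H2 := isSigmaFinite.Build _ _ _ _ sfin.
pose mu := HB.pack_for (SigmaFiniteMeasure.type (borel X) R) (Measure.sort m) H1 H2.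
have mE : m = mu by exact: eq_measure.
rewrite mE in hM hS hc *.
apply: (@weak_type_bound _ _ _ mu (fun z => riesz_kernel Q s z.1 z.2)) => //.
- exact: measurable_riesz_kernel_prod.
- by move=> z; exact: riesz_kernel_ge0.
- move=> y; apply: le_trans (hS y).
  by under eq_integral do rewrite riesz_kernelC.
Qed.

End Capacity.

(** * Near and far parts of a potential *)

Section Local.
Context {R : realType} {X : pointedMetricType R}.
Context (m : {measure set (borel X) -> \bar R}).
Local Open Scope ereal_scope.

(** Since [r <= eta / 2], the distance from [x] to [y] exceeds [eta / 2], while that from [z] to [y]
    is at most [eta] plus the distance from [x] to [y], hence at most three times the latter. *)
Lemma riesz_kernel_harnack (Q s r eta : R) (x0 x y z : X) : (0 <= Q * s)%R ->
  (0 < r)%R -> (2 * r <= eta)%R -> ball x0 r x -> ~ ball x0 eta y ->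
  ball x0 (eta / 2) z ->
  riesz_kernel Q s x y <= (3 `^ (Q * s))%:E * riesz_kernel Q s z y.
Proof.
rewrite !ballEmdist /= => Qs0 r0 r2 xr /negP; rewrite -leNgt => ye ze.
have t1 : (mdist x0 y <= mdist x0 x + mdist x y)%R by exact: metric_triangle.
have t2 : (mdist z y <= mdist x0 z + mdist x0 y)%R.
  by rewrite (metric_sym x0 z); exact: metric_triangle.
have dxy : (0 < mdist x y)%R by lra.
have dzy : (mdist z y <= 3 * mdist x y)%R by lra.
have c3 : (0 < 3 `^ (Q * s) :> R)%R by rewrite powR_gt0.
rewrite /riesz_kernel -!mdist_eq0 (gt_eqF dxy).
case: eqP => [_|/eqP zy]; first by rewrite gt0_muley ?leey// lte_fin.
have {}zy : (0 < mdist z y)%R by rewrite lt_neqAle mdist_ge0 eq_sym zy.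
rewrite -EFinM lee_fin.
rewrite [leRHS](_ : _ = (mdist z y / 3) `^ (- (Q * s)))%R; last first.
  rewrite powRM ?(ltW zy)// mulrC; congr (_ * _)%R.
  by rewrite -(powR_inv1 (a := 3))// -powRrM mulrNN mul1r.
apply: powRN_le => //; first by rewrite divr_gt0.
by rewrite ler_pdivrMr// mulrC.
Qed.

Lemma measurable_riesz_integrand (Q s : R) (x : X) (f : borel X -> R)
    (A : set (borel X)) : measurable_fun [set: borel X] f ->
  measurable_fun A (fun y => riesz_kernel Q s x y * (f y)%:E).
Proof.
move=> mf; apply: measurable_funTS; apply: emeasurable_funM.
  exact: measurable_riesz_kernel.
exact/measurable_EFinP.
Qed.

Lemma riesz_potential_far (Q s r eta : R) (x0 x z : X) (f : borel X -> R) :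
  (0 <= Q * s)%R -> (0 < r)%R -> (2 * r <= eta)%R ->
  measurable_fun [set: borel X] f -> (forall y, 0 <= f y)%R ->
  ball x0 r x -> ball x0 (eta / 2) z ->
  1 <= riesz_potential m Q s f x ->
  \int[m]_(y in ball x0 eta) (riesz_kernel Q s x y * (f y)%:E) < (2^-1)%:E ->
  (2^-1 / 3 `^ (Q * s))%:E <= riesz_potential m Q s f z.
Proof.
move=> Qs0 r0 r2 mf f0 xr ze; rewrite /riesz_potential => h1 h2.
have mB := measurable_mball x0 eta.
have mBC : measurable (~` (ball x0 eta : set (borel X))) by exact: measurableC.
have g0 u y : 0 <= riesz_kernel Q s u y * (f y)%:E.
  by rewrite mule_ge0 ?riesz_kernel_ge0// lee_fin.
have c3 : (0 < 3 `^ (Q * s) :> R)%R by rewrite powR_gt0.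
have far : \int[m]_(y in ~` (ball x0 eta : set (borel X)))
    (riesz_kernel Q s x y * (f y)%:E) <=
    (3 `^ (Q * s))%:E * \int[m]_y (riesz_kernel Q s z y * (f y)%:E).
  rewrite -ge0_integralZl_EFin ?(ltW c3)//; last exact: measurable_riesz_integrand.
  apply: (@le_trans _ _ (\int[m]_(y in ~` (ball x0 eta : set (borel X)))
      ((3 `^ (Q * s))%:E * (riesz_kernel Q s z y * (f y)%:E)))).
    apply: ge0_le_integral => //.
    - exact: measurable_riesz_integrand.
    - by apply: measurable_funeM; exact: measurable_riesz_integrand.
    move=> y /= ye; rewrite muleA lee_wpmul2r ?lee_fin//.
    exact: (riesz_kernel_harnack Qs0 r0 r2 xr ye ze).
  apply: ge0_subset_integral => //.
    by apply: measurable_funeM; exact: measurable_riesz_integrand.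
  by move=> y _; rewrite mule_ge0// lee_fin ltW.
have {h1}h1 : 1 <= \int[m]_(y in ball x0 eta) (riesz_kernel Q s x y * (f y)%:E)
    + (3 `^ (Q * s))%:E * \int[m]_y (riesz_kernel Q s z y * (f y)%:E).
  apply: (le_trans h1).
  rewrite -[in leLHS](setUv (ball x0 eta : set (borel X))) ge0_integral_setU//.
  - by rewrite leeD2l.
  - exact: measurable_riesz_integrand.
  - by apply/disj_setPS => y [].
rewrite -(@lee_pmul2l _ (3 `^ (Q * s))%:E)//.
rewrite -EFinM mulrCA mulfV ?gt_eqF// mulr1.
(* Adding two strict upper bounds [1 / 2] contradicts [h1] and avoids subtracting extended reals. *)
rewrite leNgt; apply/negP => h3.
have := lteD h2 h3; rewrite -EFinD.
have -> : (2^-1 + 2^-1 = 1 :> R)%R by lra.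
by rewrite ltNge h1.
Qed.

Lemma capacity_le_localized (Q s p : R) (E : set X) (B : set (borel X))
    (f : borel X -> R) : (0 < p)%R -> measurable B ->
  measurable_fun [set: borel X] f -> (forall y, 0 <= f y)%R ->
  (forall x, E x -> (2^-1)%:E <=
    \int[m]_(y in B) (riesz_kernel Q s x y * (f y)%:E)) ->
  capacity m Q s p E <= \int[m]_(y in B) (2 `^ p * f y `^ p)%:E.
Proof.
move=> p0 mB mf f0 hE.
pose g y := (2 * (f y * \1_B y))%R.
have mg : measurable_fun [set: borel X] g.
  by do 2 apply: measurable_funM => //; exact: measurable_indic.
have g0 y : (0 <= g y)%R by rewrite /g !mulr_ge0.
rewrite integral_indic_mul [leRHS](_ : _ = \int[m]_y (g y `^ p)%:E).
  apply: capacity_le_test => // x /hE {}hE.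
  rewrite /riesz_potential (eq_integral (fun y : borel X => 2%:E *
      (riesz_kernel Q s x y * (f y)%:E * (\1_B y)%:E))); last first.
    by move=> y _; rewrite /g EFinM EFinM muleCA !muleA.
  rewrite ge0_integralZl_EFin//.
  - rewrite -integral_indic_mul.
    apply: (@le_trans _ _ (2%:E * (2^-1)%:E)); first by rewrite -EFinM mulfV.
    by rewrite lee_wpmul2l// lee_fin.
  - by move=> y _; rewrite !mule_ge0 ?riesz_kernel_ge0 ?lee_fin.
  - apply: emeasurable_funM; first exact: measurable_riesz_integrand.
    by apply/measurable_EFinP; exact: measurable_indic.
apply: eq_integral => y _; rewrite -EFinM /g indicE; congr (_%:E).
(* Outside [B] both sides vanish, zero to the power [p] being zero for nonzero [p]. *)
by case: (y \in B); rewrite ?mulr1 ?mulr0 ?powR0 ?gt_eqF// powRM.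
Qed.

End Local.

(** * Quasiadditivity *)

Section Main.
Context {R : realType} {X : pointedMetricType R}.
Context (m : {measure set (borel X) -> \bar R}).

(** The weak type estimate bounds the capacity of a ball of radius [r] below by a multiple of [r] to
    the power [Q * s]. If [rho <= 2 * r], the capacity is also at most a multiple of [r] to the
    power [Q], impossible for small [r]. *)
Lemma small_radius_eta (Q s p Cl Cu delta M0 M : R) :
  compact [set: X] -> (m [set: borel X] < +oo)%E -> 0 < Q ->
  0 <= Q * s -> Q * s < Q -> 1 <= p -> 0 < Cl -> 0 < Cu -> 0 < delta ->
  0 <= M0 -> 0 < M ->
  (forall x r, 0 < r -> r <= delta -> ((Cl * r `^ Q)%:E <= m (ball x r))%E) ->
  (forall x r, 0 < r -> (m (ball x r) <= (Cu * r `^ Q)%:E)%E) ->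
  (forall x r, 0 < r -> (\int[m]_(y in ball x r) riesz_kernel Q s x y
     <= (M0 * r `^ (Q - Q * s))%:E)%E) ->
  (forall x, \int[m]_y riesz_kernel Q s x y <= M%:E)%E ->
  exists r0, [/\ 0 < r0, r0 <= delta &
    forall x r rho, 0 < r -> r < r0 -> eta_set m Q s p x r rho -> 2 * r < rho].
Proof.
move=> cX mfin Q0 Qs0 QsQ p1 Cl0 Cu0 delta0 M00 Mpos hl hu hM0 hM.
pose W := (1 / 2)^-1 * (1 / (2 * M)) `^ (1 - p).
have W0 : 0 < W by rewrite mulr_gt0 ?powR_gt0 ?divr_gt0 ?invr_gt0 ?divr_gt0 ?mulr_gt0.
pose B := W * (M0 + Cu) * (Cu * 2 `^ Q).
have MC0 : 0 < M0 + Cu by rewrite ltr_wpDl.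
have B0 : 0 < B by rewrite mulr_gt0 1?mulr_gt0 ?powR_gt0.
pose e := Q - Q * s; have e0 : 0 < e by rewrite subr_gt0.
have ClB : 0 < Cl / B by rewrite divr_gt0.
(* The second argument is the radius at which [B] times its power of exponent [e] equals [Cl]. *)
exists (Num.min delta ((Cl / B) `^ e^-1)); split.
- by rewrite lt_min delta0 powR_gt0.
- by rewrite ge_min lexx.
move=> x r rho r0; rewrite lt_min => /andP[rd rB] [rho0 hrho].
rewrite ltNge; apply/negP => rho2.
have {}rB : B * r `^ e < Cl.
  rewrite mulrC -ltr_pdivlMr//.
  have -> : Cl / B = ((Cl / B) `^ e^-1) `^ e.
    by rewrite -powRrM mulVf ?gt_eqF// powRr1 // ltW.
  by apply: gt0_ltr_powR; rewrite ?nnegrE ?powR_ge0 // ltW.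
have re : r `^ (- (Q * s)) * r `^ Q = r `^ e.
  by rewrite -powRD ?(gt_eqF r0) ?implybT// addrC.
pose S := (M0 + Cu) * r `^ e.
have S0 : 0 < S by rewrite mulr_gt0 ?powR_gt0.
have WS0 : 0 < W * S by exact: mulr_gt0.
have mB := measurable_mball x r.
have hS x' : (\int[m]_(y in ball x r) riesz_kernel Q s x' y <= S%:E)%E.
  apply: (le_trans (riesz_kernel_set_bound Qs0 r0 mB (hM0 x' r r0))).
  rewrite /S mulrDl EFinD leeD2l//.
  rewrite -re mulrCA EFinM lee_wpmul2l ?lee_fin ?powR_ge0//.
  exact: hu.
have cap : (((W * S)^-1)%:E * m (ball x r) <= capacity m Q s p (ball x r))%E.
  apply: le_capacity => [|f mf f0 fB]; first exact: lt_le_trans p1.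
  rewrite lee_pdivrMl//.
  by apply: (riesz_weak_type cX mfin hM mB hS) => //; exact: ltW.
have : ((Cl * r `^ Q)%:E <= (W * S)%:E * (Cu * (2 * r) `^ Q)%:E)%E.
  apply: (le_trans (hl x r r0 (ltW rd))).
  rewrite -lee_pdivrMl//.
  apply: (le_trans cap); apply: (le_trans hrho).
  apply: le_trans (hu x (2 * r) _); last by rewrite mulr_gt0.
  apply: le_measure; rewrite ?inE; [exact: measurable_mball|exact: measurable_mball|].
  exact: le_ball.
rewrite -EFinM lee_fin powRM ?(ltW r0)//.
have -> : W * S * (Cu * (2 `^ Q * r `^ Q)) = B * r `^ e * r `^ Q.
  by rewrite /S /B; ring.
by rewrite ler_pM2r ?powR_gt0// leNgt rB.
Qed.

(** Existence excludes the infimum of the empty set, which is 0 by convention. *)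
Lemma eta_le (Q s p : R) (x : X) (r c : R) : eta_exists m Q s p x r ->
  (forall rho, eta_set m Q s p x r rho -> c <= rho) -> c <= eta m Q s p x r.
Proof. by move=> ex hc; apply: lb_le_inf. Qed.

(** The infimum may not be attained; as [eta_star] is at least [r], hence positive, the factor 2
    leaves room above it. *)
Lemma eta_setP (Q s p : R) (x : X) (r : R) : 0 < r -> eta_exists m Q s p x r ->
  exists2 rho, eta_set m Q s p x r rho & rho < 2 * eta_star m Q s p x r.
Proof.
move=> r0 ex.
have e0 : 0 < eta_star m Q s p x r by rewrite lt_max r0.
apply: contrapT => h.
have : 2 * eta_star m Q s p x r <= eta m Q s p x r.
  apply: eta_le => // rho hrho; rewrite leNgt; apply/negP => lt.
  by apply: h; exists rho.
have : eta m Q s p x r <= eta_star m Q s p x r by rewrite le_max lexx orbT.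
by move=> h1 h2; lra.
Qed.

Lemma quasiadditivity_nondegenerate (Q p s : R) (a b : X) :
  compact [set: X] -> 0 < Q -> ahlfors_regular m Q -> a != b ->
  1 < p -> 0 <= s -> s < 1 ->
  exists A : R, forall (J : countType) (x : J -> X) (r : J -> R) (E : J -> set X),
    (forall j, 0 < r j) ->
    (forall j, eta_exists m Q s p (x j) (r j)) ->
    trivIset [set: J] (fun j => ball (x j) (eta_star m Q s p (x j) (r j))) ->
    (forall j, E j `<=` ball (x j) (r j)) ->
    (\esum_(j in [set: J]) capacity m Q s p (E j)
       <= A%:E * capacity m Q s p (\bigcup_j E j))%E.
Proof.
move=> cX Q0 reg ab p1 s0 s1.
have Qs0 : 0 <= Q * s by rewrite mulr_ge0// ltW.
have QsQ : Q * s < Q by rewrite gtr_pMr.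
have [Cl [Cu [delta [Cl0 Cu0 delta0 hl hu]]]] := ahlfors_regular_bounds cX Q0 reg ab.
have [Cd Cd0 hd] := quarter_ball_doubling cX Q0 Cl0 Cu0 delta0 hl hu.
have [D D0 hD] := compact_mdist_bounded cX.
have DT x : (ball x D : set (borel X)) = [set: borel X].
  by rewrite ballEmdist; apply/seteqP; split => y //= _; exact: hD.
have mfin : (m [set: borel X] < +oo)%E.
  by rewrite -(DT a) (le_lt_trans (hu _ _ D0))// ltry.
have mfn : m [set: borel X] \is a fin_num by rewrite ge0_fin_numE.
have [M0 M00 hM0] := riesz_kernel_ball_bound Qs0 QsQ (ltW Cu0) hu.
(* The summand 1 makes [M] positive, as the weak type estimate requires. *)
pose M := M0 * D `^ (Q - Q * s) + 1.
have Mpos : 0 < M by rewrite ltr_wpDl// mulr_ge0// powR_ge0.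
have hM x : (\int[m]_y riesz_kernel Q s x y <= M%:E)%E.
  by rewrite -(DT x) (le_trans (hM0 x D D0))// lee_fin lerDl.
have [r0 [r00 r0d hr0]] := small_radius_eta cX mfin Q0 Qs0 QsQ (ltW p1) Cl0 Cu0
  delta0 M00 Mpos hl hu hM0 hM.
have p0 : 0 < p by exact: lt_trans p1.
pose v0 := Cl * r0 `^ Q.
have v00 : 0 < v0 by rewrite mulr_gt0// powR_gt0.
(* The lower bound that [riesz_potential_far] gives on the half balls; [W] is the weak type constant
   at this level. *)
pose c0 : R := 2^-1 / 3 `^ (Q * s).
have c00 : 0 < c0 by rewrite divr_gt0 ?powR_gt0.
have [W W0 WE] : exists2 W, 0 < W &
    W = (c0 / 2)^-1 * (c0 / (2 * M)) `^ (1 - p) * M.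
  by eexists; last reflexivity;
    rewrite !mulr_gt0 ?powR_gt0 ?invr_gt0 ?divr_gt0 ?mulr_gt0.
(* The three summands bound the integrals of [g1], [g2] and [g3] below, up to the factor [I]. *)
pose A := v0^-1 * fine (m [set: borel X]) + 2 `^ p + Cd * W.
have A0 : 0 < A.
  apply: ltr_wpDl; last exact: mulr_gt0.
  by rewrite addr_ge0 ?powR_ge0// mulr_ge0 ?fine_ge0// invr_ge0 ltW.
exists A => J x r E rpos ex tB EB.
rewrite -lee_pdivrMl//; apply: le_capacity => // f mf f0 hf; rewrite lee_pdivrMl//.
set I := (\int[m]_y (f y `^ p)%:E)%E.
have I0 : (0 <= I)%E by apply: integral_ge0 => y _; rewrite lee_fin powR_ge0.
pose et j := eta_star m Q s p (x j) (r j).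
have et0 j : 0 < et j by rewrite lt_max rpos.
pose B j : set (borel X) := ball (x j) (et j).
have mB j : measurable (B j) by exact: measurable_mball.
pose good j := forall z, E j z -> ((2^-1)%:E <=
    \int[m]_(y in B j) (riesz_kernel Q s z y * (f y)%:E))%E.
pose bad := [set j | r j < r0 /\ ~ good j].
pose F : set (borel X) := \bigcup_(j in bad) ball (x j) (et j / 2).
have mF : measurable F.
  by apply: sub_sigma_algebra; apply: bigcup_open => j _; exact: open_mball.
have et2 j : r j < r0 -> 2 * r j <= et j.
  move=> rj; rewrite le_max; apply/orP; right; apply: eta_le => // rho hrho.
  exact/ltW/(hr0 _ _ _ (rpos j) rj hrho).
have potF z : F z -> (c0%:E <= riesz_potential m Q s f z)%E.
  move=> [j [rj /existsNP[w /not_implyP[Ew /negP]]]]; rewrite -ltNge => hw zj.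
  apply: (riesz_potential_far Qs0 (rpos j) (et2 j rj) mf f0 (EB j _ Ew) zj _ hw).
  by apply: hf; exists j.
have mFW : (m F <= W%:E * I)%E.
  rewrite WE.
  apply: (riesz_weak_type cX mfin hM mF _ mf f0 (ltW p1) Mpos c00 (ltW Mpos) potF).
  move=> z; apply: le_trans (hM z); apply: ge0_subset_integral => //.
  - exact: measurable_riesz_kernel.
  - by move=> y _; exact: riesz_kernel_ge0.
(* Each [capacity (E j)] is bounded by the integral over [B j] of one of [g1]
   (large radius), [g2] (the near part dominates) and [g3] (the far part
   dominates). *)
pose g1 (y : borel X) := ((v0^-1)%:E * I)%E.
pose g2 (y : borel X) := (2 `^ p * f y `^ p)%:E.
pose g3 (y : borel X) := (Cd%:E * (\1_F y)%:E)%E.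
have g10 y : (0 <= g1 y)%E by rewrite mule_ge0// lee_fin invr_ge0 ltW.
have g20 y : (0 <= g2 y)%E by rewrite lee_fin mulr_ge0 ?powR_ge0.
have g30 y : (0 <= g3 y)%E by rewrite mule_ge0 ?lee_fin// ltW.
have mg1 : measurable_fun [set: borel X] g1 by exact: measurable_cst.
have mfp : measurable_fun [set: borel X] (fun y => (f y `^ p)%:E).
  by apply/measurable_EFinP; exact: (measurableT_comp (measurable_powR p)).
have mg2 : measurable_fun [set: borel X] g2.
  by rewrite /g2; under eq_fun do rewrite EFinM; exact: measurable_funeM.
have m1F : measurable_fun [set: borel X] (fun y => (\1_F y)%:E : \bar R).
  by apply/measurable_EFinP; exact: measurable_indic.
have mg3 : measurable_fun [set: borel X] g3 by exact: measurable_funeM.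
pose g y := (g1 y + g2 y + g3 y)%E.
have g0 y : (0 <= g y)%E by rewrite !adde_ge0.
have mg : measurable_fun [set: borel X] g.
  by apply: emeasurable_funD => //; exact: emeasurable_funD.
have intg : (\int[m]_y g y <= A%:E * I)%E.
  rewrite ge0_integralD//; last 2 first.
  - by move=> y _; rewrite adde_ge0.
  - exact: emeasurable_funD.
  rewrite ge0_integralD//.
  rewrite /g1 /g2 /g3 integral_cst//.
  under [X in (_ + X + _)%E]eq_integral do rewrite EFinM.
  rewrite !ge0_integralZl_EFin ?powR_ge0 ?(ltW Cd0)//; last first.
    by move=> y _; rewrite lee_fin powR_ge0.
  rewrite integral_indic// setIT -/I.
  rewrite /A 2!EFinD !ge0_muleDl ?lee_fin ?addr_ge0 ?mulr_ge0 ?powR_ge0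
    ?invr_ge0 ?fine_ge0 ?(ltW v00) ?(ltW Cd0) ?(ltW W0)//.
  apply: leeD; last first.
    by rewrite EFinM -muleA lee_wpmul2l// lee_fin ltW.
  by rewrite leeD2r// EFinM fineK// muleAC.
have g1g y : (g1 y <= g y)%E by rewrite /g -addeA leeDl// adde_ge0.
have g2g y : (g2 y <= g y)%E by rewrite /g addeAC leeDr// adde_ge0.
have g3g y : (g3 y <= g y)%E by rewrite /g leeDr// adde_ge0.
have lint (h : borel X -> \bar R) j : (forall y, 0 <= h y)%E ->
    measurable_fun [set: borel X] h -> (forall y, h y <= g y)%E ->
    (\int[m]_(y in B j) h y <= \int[m]_(y in B j) g y)%E.
  by move=> h0 mh hg; apply: ge0_le_integral => //; exact: measurable_funTS.
apply: le_trans intg.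
apply: le_trans (esum_integral_disjoint m tB mB mg g0).
apply: le_esum => j _.
(* For a large radius, [f] itself tests [E j], and [B j] has mass at least [v0]. The disjoint balls
   are counted through the integral of the constant [g1]. *)
have [rj|rj] := leP r0 (r j).
  apply: le_trans (lint g1 j g10 mg1 g1g).
  rewrite integral_cst//.
  apply: (@le_trans _ _ I).
    by apply: capacity_le_test => // z Ez; apply: hf; exists j.
  rewrite muleAC -[leLHS]mul1e lee_wpmul2r//.
  rewrite -(@lee_pmul2l _ v0%:E) ?lte_fin// mule1 muleA -EFinM mulfV ?gt_eqF// mul1e.
  apply: (le_trans (hl (x j) r0 r00 r0d)).
  apply: le_measure; rewrite ?inE//; first exact: measurable_mball.
  by apply: le_ball; rewrite (le_trans rj)// le_max lexx.
have [gj|bj] := pselect (good j).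
  apply: le_trans (lint g2 j g20 mg2 g2g).
  exact: capacity_le_localized.
apply: le_trans (lint g3 j g30 mg3 g3g).
have [rho [rho0 hrho] rho2] := eta_setP (rpos j) (ex j).
apply: (le_trans (le_capacity_subset m Q s p (EB j))).
apply: (le_trans hrho); apply: (le_trans (hd _ _ rho0)).
rewrite ge0_integralZl_EFin ?(ltW Cd0)//; last exact: measurable_funTS.
rewrite integral_indic//.
apply: lee_wpmul2l; first by rewrite lee_fin ltW.
apply: le_measure; rewrite ?inE; [exact: measurable_mball|exact: measurableI|].
rewrite -/(et j) in rho2.
(* As [rho / 4 < et j / 2], the quarter ball lies in the half ball, hence in both [F] and [B j]. *)
move=> y yr; split.
  exists j => //; apply: le_ball yr; lra.
by apply: le_ball yr; have := et0 j; lra.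
Qed.

Lemma hausdorff_measure_subsingleton (Q : R) : 0 < Q ->
  (forall x y : X, x = y) -> (hausdorff_measure Q [set: X] <= 0)%E.
Proof.
move=> Q0 X1.
have diam0 : diam [set: X] = 0%E.
  rewrite /diam; apply/max_idPl; apply: ge_ereal_sup => _ [x _ [y _ <-]].
  by rewrite (X1 x y) mdistxx.
apply: ge_ereal_sup => _ [d /= d0 <-]; apply: ereal_inf_lbound.
(* The space itself, repeated, is a cover by sets of diameter 0, and each term vanishes since [Q] is
   nonzero. *)
exists (fun=> [set: X]).
  by split => [z _|k]; [exists 0%N|rewrite diam0 lee_fin ltW].
by apply: eseries0 => k _ _; rewrite diam0 poweR0r// gt_eqF.
Qed.

(* Integrals against the zero measure vanish, even of the kernel's value +oo on
   the diagonal, so that nonempty sets have no test function. *)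
Lemma eta_exists_null (Q s p : R) (x : X) (r : R) :
  m [set: borel X] = 0%E -> 0 < p -> 0 < r -> ~ eta_exists m Q s p x r.
Proof.
move=> m0 p0 r0 [rho [_]].
have mB : (m (ball x rho) <= 0)%E.
  by rewrite -m0; apply: le_measure; rewrite ?inE//; exact: measurable_mball.
move=> /le_trans /(_ mB); rewrite leNgt => /negP; apply.
rewrite (@lt_le_trans _ _ +oo%E)//; apply: le_capacity => // f mf f0 hf.
have := hf x (ballxx _ r0); rewrite /riesz_potential.
rewrite null_set_integral//; last exact: measurable_riesz_integrand.
by rewrite leNgt lte01.
Qed.

End Main.

Theorem theorem0p3 (R : realType) (X : pointedMetricType R)
    (m : {measure set (borel X) -> \bar R}) (Q p p' s : R)
    (X_compact : compact [set: X]) (Q_gt0 : 0 < Q)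
    (m_hausdorff : is_hausdorff_measure m Q)
    (X_regular : ahlfors_regular m Q)
    (p_gt1 : 1 < p) (pp' : p^-1 + p'^-1 = 1)
    (s_ge : p'^-1 <= s) (s_lt1 : s < 1) :
  exists A : R, forall (J : countType) (x : J -> X) (r : J -> R) (E : J -> set X),
    (forall j, 0 < r j) ->
    (forall j, eta_exists m Q s p (x j) (r j)) ->
    trivIset [set: J] (fun j => ball (x j) (eta_star m Q s p (x j) (r j))) ->
    (forall j, compact (E j)) ->
    (forall j, E j `<=` ball (x j) (r j)) ->
    (\esum_(j in [set: J]) capacity m Q s p (E j)
       <= A%:E * capacity m Q s p (\bigcup_j E j))%E.
Proof.
have p_gt0 : 0 < p by exact: lt_trans p_gt1.
have s_ge0 : 0 <= s.
  apply: le_trans s_ge; rewrite (_ : p'^-1 = 1 - p^-1); last first.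
    by rewrite -pp' addrC addKr.
  by rewrite subr_ge0 invf_le1// ltW.
(* On a one-point space the diameter is 0 and regularity is vacuous; there the Hausdorff measure
   gives total mass zero. *)
have [[a [b ab]]|X1] := pselect (exists a b : X, a != b).
  have [A hA] := quasiadditivity_nondegenerate X_compact Q_gt0 X_regular ab
    p_gt1 s_ge0 s_lt1.
  by exists A => J x r E r0 ex tB _; exact: hA.
have m0 : m [set: borel X] = 0%E.
  apply/eqP; rewrite eq_le measure_ge0 andbT m_hausdorff//.
  apply: hausdorff_measure_subsingleton => // a b.
  by apply/eqP; apply: contrapT => /negP ab; apply: X1; exists a, b.
(* No [eta] exists for the zero measure, so the family is empty. *)
exists 0 => J x r E r0 ex _ _ _; rewrite mul0e esum1// => j _.
by case: (eta_exists_null m0 p_gt0 (r0 j) (ex j)).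
Qed.
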